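(* Let $\alpha,\beta$ be real and let $g$ be real with $0<|g|<1$. Let $P_n(x;a,b,c\,|\,q)$ denote the monic big $q$-Jacobi polynomials. Then for every $n\ge0$ $$\lim_{\epsilon\to0}\,(1-g^2)^{-n/2}\,P_n\!\left(x\sqrt{1-g^2};\,e^{2\epsilon\beta},\,-e^{\epsilon(2\alpha+1)},\,-g\,\Big|\,-e^{\epsilon}\right)=C_n\!\left(x;\alpha,\beta,\frac{g}{\sqrt{1-g^2}}\right),$$ where $C_n(x;\alpha,\beta,\gamma)$ are the Chihara polynomials. That is, the Chihara polynomials are a $q\to-1$ limit of the big $q$-Jacobi polynomials.
   Context: The monic big $q$-Jacobi polynomials $P_n(x)=P_n(x;a,b,c\,|\,q)$ are defined by $P_{-1}(x)=0$, $P_0(x)=1$ and $$xP_n(x)=P_{n+1}(x)+(1-\upsilon_n-\nu_n)P_n(x)+\upsilon_{n-1}\nu_nP_{n-1}(x),$$ $$\upsilon_n=\frac{(1-aq^{n+1})(1-abq^{n+1})(1-cq^{n+1})}{(1-abq^{2n+1})(1-abq^{2n+2})},\qquad \nu_n=-acq^{n+1}\frac{(1-q^n)(1-abc^{-1}q^n)(1-bq^n)}{(1-abq^{2n})(1-abq^{2n+1})}.$$ The Chihara polynomials $C_n(x;\alpha,\beta,\gamma)$ are the monic polynomials $$C_{2n}(x)=(-1)^n\frac{(\alpha+1)_n}{(n+\alpha+\beta+1)_n}\,{}_2F_1\!\left[{-n,\;n+\alpha+\beta+1\atop \alpha+1};x^2-\gamma^2\right],$$ $$C_{2n+1}(x)=(-1)^n\frac{(\alpha+2)_n}{(n+\alpha+\beta+2)_n}(x-\gamma)\,{}_2F_1\!\left[{-n,\;n+\alpha+\beta+2\atop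 \alpha+2};x^2-\gamma^2\right],$$ where $(a)_n=a(a+1)\cdots(a+n-1)$, $(a)_0=1$, ${}_2F_1$ is the Gauss hypergeometric series, and products of Pochhammer prefactors with ${}_2F_1$ are understood as polynomials (expanded termwise). It is assumed that $\alpha+\beta\notin\{-1,-2,-3,\ldots\}$, so that all coefficients are defined; the limit is through real nonzero $\epsilon$. *)

(* Defs.v *)
From HB Require Import structures.
From mathcomp Require Import all_boot all_order all_algebra.
Set Implicit Arguments.
Unset Strict Implicit.
Unset Printing Implicit Defensive.
Import Order.TTheory GRing.Theory Num.Theory.
Local Open Scope ring_scope.

Section Polynomials.
Variable F : numFieldType.
Implicit Types a b c q alpha beta gamma : F.

Definition upsilon a b c q (n : nat) : F :=
  (1 - a * q ^+ n.+1) * (1 - a * b * q ^+ n.+1) * (1 - c * q ^+ n.+1) /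
  ((1 - a * b * q ^+ (2 * n + 1)) * (1 - a * b * q ^+ (2 * n + 2))).

Definition nu a b c q (n : nat) : F :=
  - (a * c * q ^+ n.+1) *
  ((1 - q ^+ n) * (1 - a * b * c^-1 * q ^+ n) * (1 - b * q ^+ n) /
   ((1 - a * b * q ^+ (2 * n)) * (1 - a * b * q ^+ (2 * n + 1)))).

(* Monic big q-Jacobi polynomials; since P_{-1} = 0, the recurrence at index 0
   reads x P_0 = P_1 + (1 - upsilon_0 - nu_0) P_0. *)
Fixpoint big_qJacobi a b c q (n : nat) : {poly F} :=
  match n with
  | 0 => 1
  | m.+1 =>
      ('X - (1 - upsilon a b c q m - nu a b c q m)%:P) * big_qJacobi a b c q m
      - match m with
        | 0 => 0
        | l.+1 => (upsilon a b c q l * nu a b c q m) *: big_qJacobi a b c q l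
        end
  end.

Definition pochhammer (a : F) (n : nat) : F := \prod_(i < n) (a + i%:R).

(* The polynomial (c)_n 2F1(-n, b; c; X), expanded termwise: the k-th term
   carries (c)_n / (c)_k = (c + k)_(n - k), which makes sense even if c is a
   nonpositive integer. *)
Definition poch_hyp2F1 (n : nat) (b c : F) : {poly F} :=
  \sum_(k < n.+1)
    (pochhammer (- n%:R) k * pochhammer b k / (k`!)%:R
     * pochhammer (c + k%:R) (n - k)) *: 'X^k.

Lemma pochhammerD (a : F) (m n : nat) :
  pochhammer a (m + n) = pochhammer a m * pochhammer (a + m%:R) n.
Proof.
rewrite /pochhammer big_split_ord /=; congr (_ * _).
by apply: eq_bigr => i _; rewrite natrD addrA.
Qed.

Lemma poch_hyp2F1E (n : nat) (b c : F) : pochhammer c n != 0 ->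
  poch_hyp2F1 n b c = pochhammer c n *:
    \sum_(k < n.+1)
      (pochhammer (- n%:R) k * pochhammer b k
       / (pochhammer c k * (k`!)%:R)) *: 'X^k.
Proof.
move=> cn0; rewrite /poch_hyp2F1 scaler_sumr; apply: eq_bigr => k _.
have cnE := pochhammerD c k (n - k).
have kn : (k <= n)%N by rewrite -ltnS ltn_ord.
rewrite (subnKC kn) in cnE.
rewrite scalerA; congr (_ *: _).
move: cn0; rewrite cnE mulf_eq0 negb_or => /andP[ck0 _].
rewrite invfM [RHS]mulrCA -[LHS]mulrA; congr (_ * _).
by rewrite [RHS]mulrACA divff // mul1r mulrC.
Qed.

Definition chihara alpha beta gamma (m : nat) : {poly F} :=
  let n := m./2 in
  if odd m then
    ((- 1) ^+ n / pochhammer (n%:R + alpha + beta + 2) n) *: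
      (('X - gamma%:P) *
       (poch_hyp2F1 n (n%:R + alpha + beta + 2) (alpha + 2)
          \Po ('X^2 - (gamma ^+ 2)%:P)))
  else
    ((- 1) ^+ n / pochhammer (n%:R + alpha + beta + 1) n) *:
      (poch_hyp2F1 n (n%:R + alpha + beta + 1) (alpha + 1)
         \Po ('X^2 - (gamma ^+ 2)%:P)).

End Polynomials.

(* Main.v *)
(** As q = - exp eps tends to -1, every factor 1 - a q^k, 1 - b q^k, 1 - ab q^k of the
    recurrence coefficients tends either to 2 or to 0, depending on the parity of k, and
    each coefficient contains one vanishing factor above and one below, whose quotient
    (1 - exp (eps A)) / (1 - exp (eps B)) tends to A / B.  Hence the big q-Jacobi
    polynomials converge to the solution of a three-term recurrence with diagonal
    coefficients (-1)^n g and off-diagonal coefficients proportional to 1 - g^2.  After the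
    rescaling by sqrt (1 - g^2) this is the recurrence of the Chihara polynomials, which
    in terms of y = x^2 - gamma^2 amounts to two contiguous relations between the monic
    polynomials proportional to 2F1(-n, n+u; t; y) and 2F1(-n, n+u+1; t+1; y). *)
Require Import Defs.
From HB Require Import structures.
From mathcomp Require Import all_boot all_order all_algebra.
From mathcomp Require Import all_classical all_reals all_analysis.
From mathcomp Require Import ring zify.
Set Implicit Arguments.
Unset Strict Implicit.
Unset Printing Implicit Defensive.
Import Order.TTheory GRing.Theory Num.Theory.
Import numFieldNormedType.Exports.
Local Open Scope classical_set_scope.
Local Open Scope ring_scope.

(** * Monic terminating hypergeometric polynomials and their two contiguous relations *)

Section MonicHypergeometric.
Variable F : numFieldType.
Implicit Types a t u : F.

Lemma pochhammer_recl a n : pochhammer a n.+1 = a * pochhammer (a + 1) n.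
Proof. by rewrite -add1n pochhammerD /pochhammer big_ord1 addr0. Qed.

Lemma pochhammer_recr a n : pochhammer a n.+1 = pochhammer a n * (a + n%:R).
Proof. by rewrite /pochhammer big_ord_recr. Qed.

Lemma pochhammer_oppn n k :
  pochhammer (- n%:R : F) k = (- 1) ^+ k * (n ^_ k)%:R.
Proof.
elim: k => [|k IHk]; first by rewrite /pochhammer big_ord0 ffactn0 mulr1.
rewrite pochhammer_recr IHk ffactnSr natrM exprS.
have [le_kn|lt_nk] := leqP k n; first by rewrite natrB //; ring.
by rewrite ffact_small // !(mul0r, mulr0).
Qed.

Lemma pochhammer_neq0 a n :
  (forall k : nat, a + k%:R != 0) -> pochhammer a n != 0.
Proof. by move=> a_neq0; apply/prodf_neq0 => i _; apply: a_neq0. Qed.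

(* The quotient (t)_n / (t)_k is written (t + k)_(n-k), so that t may be a nonpositive integer. *)
Definition monic_hyp_coef t u n k : F :=
  (- 1) ^+ (n - k) * 'C(n, k)%:R *
  (pochhammer (t + k%:R) (n - k) / pochhammer (u + (n + k)%:R) (n - k)).

Definition monic_hyp t u n : {poly F} := \poly_(k < n.+1) monic_hyp_coef t u n k.

Lemma monic_hyp_coef_small t u n k : (n < k)%N -> monic_hyp_coef t u n k = 0.
Proof. by move=> lt_nk; rewrite /monic_hyp_coef bin_small // mulr0 mul0r. Qed.

Lemma coef_monic_hyp t u n k : (monic_hyp t u n)`_k = monic_hyp_coef t u n k.
Proof. by rewrite coef_poly ltnS; case: leqP => // /monic_hyp_coef_small->. Qed.

Lemma monic_hyp_coefnn t u n : monic_hyp_coef t u n n = 1.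
Proof. by rewrite /monic_hyp_coef subnn binn /pochhammer !big_ord0 divr1 !mulr1. Qed.

(** The factor (n+u)_k of [poch_hyp2F1] cancels against the beginning of (n+u)_n = (n+u)_k
    (u+n+k)_(n-k), and (-n)_k / k! is a signed binomial coefficient. The left side has the shape of
    the prefactor and series in [chihara], for both parities. *)
Lemma monic_hypE t u n : (forall k : nat, u + k%:R != 0) ->
  ((- 1) ^+ n / pochhammer (n%:R + u) n) *: poch_hyp2F1 n (n%:R + u) t
  = monic_hyp t u n.
Proof.
move=> u_neq0; rewrite /poch_hyp2F1 /monic_hyp poly_def scaler_sumr.
apply: eq_bigr => -[k /=]; rewrite ltnS => le_kn _.
rewrite scalerA; congr (_ *: _).
have un_neq0 d j : pochhammer (u + d%:R) j != 0.
  by apply: pochhammer_neq0 => i; rewrite -addrA -natrD.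
rewrite /monic_hyp_coef pochhammer_oppn -bin_ffact natrM.
have -> : pochhammer (n%:R + u) n
    = pochhammer (n%:R + u) k * pochhammer (u + (n + k)%:R) (n - k).
  by rewrite -{2}(subnKC le_kn) pochhammerD natrD [n%:R + u]addrC addrA.
have -> : (- 1) ^+ n = (- 1) ^+ k * (- 1) ^+ (n - k) :> F.
  by rewrite -exprD subnKC.
have := un_neq0 n k; rewrite [u + _]addrC => nz1.
have nz2 := un_neq0 (n + k)%N (n - k)%N.
have nz3 : (k`!)%:R != 0 :> F by rewrite pnatr_eq0 -lt0n fact_gt0.
have sqr1 : (- 1) ^+ k * (- 1) ^+ k = 1 :> F by rewrite -expr2 sqrr_sign.
set e := (- 1) ^+ k in sqr1 *.
(* The sign (-1)^k occurs twice, once from (-1)^n and once from (-n)_k. *)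
transitivity (e * e * ((-1) ^+ (n - k) * 'C(n, k)%:R *
  (pochhammer (t + k%:R) (n - k) / pochhammer (u + (n + k)%:R) (n - k)))).
  by field; rewrite nz1 nz2 nz3.
by rewrite sqr1 mul1r.
Qed.

(** Coefficients are compared: with C(n,k) expressed through C(n+1,k), and all Pochhammer symbols
    through (t+1+k)_d and (v+1)_d, where d = n-k and v = u+n+1+k, a rational identity remains. *)
Lemma monic_hyp_raise t u n : (forall k : nat, u + k%:R != 0) ->
  monic_hyp (t + 1) (u + 1) n.+1 =
  monic_hyp t u n.+1
  - (n.+1%:R * (n.+1%:R + u - t)
      / ((u + (2 * n + 1)%:R) * (u + (2 * n + 2)%:R)))
    *: monic_hyp (t + 1) (u + 1) n.
Proof.
move=> u_neq0; apply/polyP => k.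
rewrite coefB coefZ !coef_monic_hyp.
have [le_kn|lt_nk|->] := ltngtP k n.+1; last first.
- by rewrite !monic_hyp_coefnn monic_hyp_coef_small // mulr0 subr0.
- by rewrite !monic_hyp_coef_small ?mulr0 ?subr0 //; lia.
rewrite ltnS in le_kn; rewrite /monic_hyp_coef subSn //.
have binE : n.+1%:R * 'C(n, k)%:R = (n.+1%:R - k%:R) * 'C(n.+1, k)%:R :> F.
  by rewrite -natrB; [rewrite -!natrM -mul_bin_down | lia].
have nS : n.+1%:R != 0 :> F by rewrite pnatr_eq0.
have -> : 'C(n, k)%:R = (n.+1%:R - k%:R) * 'C(n.+1, k)%:R / n.+1%:R :> F.
  by rewrite -binE mulrC mulKf.
move: le_kn => /subnKC; set d := (n - k)%N => nE; rewrite -nE.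
rewrite [pochhammer (t + k%:R) _]pochhammer_recl.
rewrite [pochhammer (t + 1 + k%:R) _.+1]pochhammer_recr.
have -> : t + k%:R + 1 = t + 1 + k%:R by ring.
set v := u + ((k + d).+1 + k)%:R.
have nz1 : v != 0 by exact: u_neq0.
have nz2 : pochhammer (v + 1) d != 0.
  by apply: pochhammer_neq0 => i; rewrite /v -addrA nat1r -addrA -natrD.
have nz3 : u + (2 * (k + d) + 1)%:R != 0 by exact: u_neq0.
have nz4 : u + (2 * (k + d) + 2)%:R != 0 by exact: u_neq0.
(* Two factorizations of (v)_(d+1). Since v + d = u + 2n + 1, the symbol (v)_d follows from (v+1)_d
   by a division. *)
have vd : v * pochhammer (v + 1) d = pochhammer v d * (v + d%:R).
  by rewrite -pochhammer_recl pochhammer_recr.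
have -> : pochhammer (u + 1 + ((k + d).+1 + k)%:R) d.+1
    = pochhammer (v + 1) d * (u + (2 * (k + d) + 2)%:R).
  rewrite pochhammer_recr /v.
  by congr (pochhammer _ _ * _); rewrite ?natrD ?natrM ?mulrS; ring.
have -> : pochhammer v d.+1 = v * pochhammer (v + 1) d.
  exact: pochhammer_recl.
have -> : pochhammer (u + 1 + (k + d + k)%:R) d
    = v * pochhammer (v + 1) d / (u + (2 * (k + d) + 1)%:R).
  apply: (canRL (mulfK nz3)); rewrite vd /v.
  by congr (pochhammer _ _ * _); rewrite ?natrD ?natrM ?mulrS; ring.
move: nz1 nz2 nz3 nz4 nS; rewrite /v -nE.
set X := pochhammer (_ + 1) _; set Y := pochhammer _ _.
rewrite !exprS !(natrD, natrM, mulrS, mulr0n, addr0) => nz1 nz2 nz3 nz4 nS.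
field; rewrite ?(mulrS, mulr0n, addr0).
by rewrite nz1 nz2 nz3 nz4 nS.
Qed.

Lemma monic_hyp_recr t u n : (forall k : nat, u + k%:R != 0) ->
  monic_hyp t u n.+1 =
  'X * monic_hyp (t + 1) (u + 1) n
  - ((u + n%:R) * (t + n%:R)
      / ((u + (2 * n)%:R) * (u + (2 * n + 1)%:R))) *: monic_hyp t u n.
Proof.
move=> u_neq0; apply/polyP => k.
rewrite coefB coefZ coefXM !coef_monic_hyp.
have [le_kn|lt_nk|->] := ltngtP k n.+1; last first.
- by rewrite /= !monic_hyp_coefnn monic_hyp_coef_small // mulr0 subr0.
- by rewrite !monic_hyp_coef_small ?mulr0 ?subr0 //; [case: eqP | lia | lia].
rewrite ltnS in le_kn.
have nz3 := u_neq0 (2 * n)%N; have nz4 := u_neq0 (2 * n + 1)%N.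
have nz1 := u_neq0 (n + k)%N.
have nS : n.+1%:R != 0 :> F by rewrite pnatr_eq0.
set v := u + (n + k)%:R.
set d := (n - k)%N; have dE : (k + d)%N = n := subnKC le_kn.
have nz2 : pochhammer (v + 1) d != 0.
  by apply: pochhammer_neq0 => i; rewrite /v -addrA nat1r -addrA -natrD.
have vd : v * pochhammer (v + 1) d = pochhammer v d * (v + d%:R).
  by rewrite -pochhammer_recl pochhammer_recr.
have binE : n.+1%:R * 'C(n, k)%:R = (n.+1%:R - k%:R) * 'C(n.+1, k)%:R :> F.
  by rewrite -natrB; [rewrite -!natrM -mul_bin_down | lia].
have cE : 'C(n, k)%:R = (n.+1%:R - k%:R) * 'C(n.+1, k)%:R / n.+1%:R :> F.
  by rewrite -binE mulrC mulKf.
have lhsE : monic_hyp_coef t u n.+1 k = (- 1) ^+ d.+1 * 'C(n.+1, k)%:R *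
    (pochhammer (t + k%:R) d * (t + n%:R)
      / (pochhammer (v + 1) d * (u + (2 * n + 1)%:R))).
  rewrite /monic_hyp_coef subSn // -/d !pochhammer_recr /v -dE.
  by congr (_ * (_ * _ / (pochhammer _ _ * _)));
     rewrite !(natrD, natrM, mulrS); ring.
have rhsE : monic_hyp_coef t u n k = (- 1) ^+ d * 'C(n, k)%:R *
    (pochhammer (t + k%:R) d * (u + (2 * n)%:R) / (v * pochhammer (v + 1) d)).
  rewrite /monic_hyp_coef -/d vd -/v.
  have -> : v + d%:R = u + (2 * n)%:R.
    by rewrite /v -dE !(natrD, natrM); ring.
  by rewrite -mulf_div divff // mulr1.
(* Multiplication by ['X] lowers the index by one. Pascal's rule replaces C(n,k-1) by C(n+1,k) -
   C(n,k), which is also correct at k = 0, where it vanishes. *)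
have midE : (if k == 0 then 0 else monic_hyp_coef (t + 1) (u + 1) n k.-1)
   = (- 1) ^+ d.+1 * ('C(n.+1, k)%:R - 'C(n, k)%:R) *
    (pochhammer (t + k%:R) d * (t + n%:R) / (v * pochhammer (v + 1) d)).
  rewrite vd.
  case: (k) @v @d le_kn nz1 nz2 dE vd binE cE lhsE rhsE => [|j] v d /= le_kn nz1 nz2 dE vd *.
    by rewrite !bin0 subrr mulr0 mul0r.
  rewrite /monic_hyp_coef.
  have -> : (n - j = d.+1)%N by rewrite /d; lia.
  have -> : 'C(n.+1, j.+1)%:R - 'C(n, j.+1)%:R = 'C(n, j)%:R :> F.
    by rewrite binS natrD addrC addKr.
  rewrite !pochhammer_recr /v -dE.
  by congr (_ * (pochhammer _ _ * _ / (pochhammer _ _ * _)));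
     rewrite !(natrD, natrM, mulrS); ring.
rewrite lhsE rhsE midE cE.
move: nz1 nz2 nz3 nz4 nS; rewrite /v.
set X := pochhammer (_ + 1) _; set Y := pochhammer _ _.
rewrite -dE !exprS !(natrD, natrM, mulrS, mulr0n, addr0) => nz1 nz2 nz3 nz4 nS.
field; rewrite ?(mulrS, mulr0n, addr0).
by rewrite nz1 nz2 nz3 nz4 nS.
Qed.
End MonicHypergeometric.

(** * Limits of exponential factors and of their degenerate quotients *)

Section Limits.
Variable R : realType.
Implicit Types A B : R.

Lemma continuous_expRM A : continuous (fun eps : R => expR (eps * A)).
Proof.
by move=> eps; apply: continuous_comp; [exact: mulrr_continuous | exact: continuous_expR].
Qed.

Lemma cvg_expRM A : expR (eps * A) @[eps --> (0 : R)^'] --> (1 : R).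
Proof.
have /continuous_withinNx := @continuous_expRM A 0.
by rewrite mul0r expR0.
Qed.

(** L'Hôpital's rule at 0: both terms vanish there, and the derivative of the denominator has no
    zero because B is nonzero. The case A = 0 does occur, in [nu] at index 0. *)
Lemma cvg_onesub_expR_ratio A B : B != 0 ->
  (1 - expR (eps * A)) / (1 - expR (eps * B)) @[eps --> (0 : R)^'] --> A / B.
Proof.
move=> B0.
have dE C (x : R) : is_derive x 1 (fun eps => 1 - expR (eps * C)) (- (C * expR (x * C))).
  have dM : is_derive x 1 (fun eps : R => eps * C) C.
    have -> : (fun eps : R => eps * C) = C \*: (@id R).
      by apply/funext => y /=; rewrite mulrC.
    by apply: is_derive_eq; rewrite /GRing.scale /= mulr1.
  have dexp := is_derive1_comp (f := @expR R) (g := fun eps : R => eps * C)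
    (is_derive_expR (x * C)) dM.
  have := is_deriveB (is_derive_cst (1 : R) x 1) dexp.
  rewrite sub0r [C * _]mulrC; exact.
have cvg0 C : 1 - expR (eps * C) @[eps --> (0 : R)] --> (0 : R).
  rewrite -[X in _ --> X](subrr 1); apply: cvgB; first exact: cvg_cst.
  by have := @continuous_expRM C 0; rewrite /continuous_at mul0r expR0.
apply: (lhopital (a := -1) (b := 1) (df := fun x => - (A * expR (x * A)))
   (dg := fun x => - (B * expR (x * B)))) => //.
- by rewrite in_itv /= ltrN10 ltr01.
- by move=> x _; rewrite oppr_eq0 mulf_neq0 // gt_eqF // expR_gt0.
have -> : A / B = - (A * 1) / - (B * 1) by rewrite !mulr1 divrNN.
have cvgE C : - (C * expR (x * C)) @[x --> (0:R)] --> - (C * 1).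
  apply: cvgN; apply: cvgM; first exact: cvg_cst.
  by have := @continuous_expRM C 0; rewrite /continuous_at mul0r expR0.
by apply: cvgM => //; apply: cvgV => //; rewrite oppr_eq0 mulr1.
Qed.
End Limits.

(** * The three-term recurrence of the Chihara polynomials *)

Section ChiharaRecurrence.
Variables (F : numFieldType) (alpha beta gamma : F).
Hypothesis hab : forall k : nat, alpha + beta != - k.+1%:R.

Let u_neq0 (k : nat) : alpha + beta + 1 + k%:R != 0.
Proof. by rewrite -addrA nat1r addr_eq0. Qed.

Let u1_neq0 (k : nat) : alpha + beta + 1 + 1 + k%:R != 0.
Proof. by rewrite -[_ + 1 + k%:R]addrA nat1r. Qed.

Lemma chihara_double m : chihara alpha beta gamma m.*2 =
  monic_hyp (alpha + 1) (alpha + beta + 1) m \Po ('X^2 - (gamma ^+ 2)%:P).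
Proof.
rewrite /chihara odd_double doubleK -comp_polyZ -(monic_hypE _ _ u_neq0).
by rewrite !addrA.
Qed.

Lemma chihara_doubleS m : chihara alpha beta gamma m.*2.+1 =
  ('X - gamma%:P) *
  (monic_hyp (alpha + 2) (alpha + beta + 2) m \Po ('X^2 - (gamma ^+ 2)%:P)).
Proof.
rewrite /chihara /= odd_double /= uphalf_double scalerAr -comp_polyZ.
by rewrite -(monic_hypE (alpha + 2)) ?addrA.
Qed.

(** In [monic_hyp_recr] the variable y becomes x^2 - gamma^2 = (x + gamma)(x - gamma). The factor x
    - gamma completes the odd polynomial, and x + gamma stays as the linear coefficient. *)
Lemma chihara_recr_even m :
  chihara alpha beta gamma m.*2.+2 =
  ('X + gamma%:P) * chihara alpha beta gamma m.*2.+1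
  - ((alpha + beta + m%:R + 1) * (alpha + m%:R + 1)
      / ((alpha + beta + (2 * m + 1)%:R) * (alpha + beta + (2 * m + 2)%:R)))
    *: chihara alpha beta gamma m.*2.
Proof.
have := monic_hyp_recr (alpha + 1) m u_neq0.
rewrite -doubleS !chihara_double chihara_doubleS => ->.
rewrite comp_polyB comp_polyM comp_polyX comp_polyZ mulrA; congr (_ * _ - _ *: _).
- by rewrite polyC_exp; ring.
- by congr (monic_hyp _ _ _ \Po _); ring.
- by congr (_ * _ / (_ * _)); rewrite ?natrD; ring.
Qed.

(** This is [monic_hyp_raise] at y = x^2 - gamma^2, multiplied by x - gamma. *)
Lemma chihara_recr_odd m :
  chihara alpha beta gamma m.*2.+3 =
  ('X - gamma%:P) * chihara alpha beta gamma m.*2.+2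
  - (m.+1%:R * (beta + m.+1%:R)
      / ((alpha + beta + (2 * m + 2)%:R) * (alpha + beta + (2 * m + 3)%:R)))
    *: chihara alpha beta gamma m.*2.+1.
Proof.
have := monic_hyp_raise (alpha + 1) m u_neq0.
have -> : alpha + 1 + 1 = alpha + 2 by ring.
have -> : alpha + beta + 1 + 1 = alpha + beta + 2 by ring.
rewrite -doubleS chihara_double !chihara_doubleS => ->.
rewrite comp_polyB comp_polyZ mulrBr -!scalerAr; congr (_ - _ *: _).
by congr (_ * _ / (_ * _)); rewrite ?natrD; ring.
Qed.
End ChiharaRecurrence.

(** * Limits of the big q-Jacobi coefficients and polynomials as q tends to -1 *)

Lemma oddM2 n : odd (2 * n) = false. Proof. by rewrite oddM. Qed.

Lemma oddM2D1 n : odd (2 * n + 1). Proof. by rewrite addn1 oddS oddM2. Qed.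

Lemma oddM2D2 n : odd (2 * n + 2) = false.
Proof. by rewrite addn2 /= oddM2. Qed.

Section CoefficientLimits.
Variables (R : realType) (alpha beta g : R).
Hypothesis g0 : g != 0.
Hypothesis hab : forall k : nat, alpha + beta != - k.+1%:R.

Let a (eps : R) := expR (2 * eps * beta).
Let b (eps : R) := - expR (eps * (2 * alpha + 1)).
Let q (eps : R) := - expR eps.
(** The exponent of the product ab, which equals -exp (eps s). *)
Let s := 2 * alpha + 2 * beta + 1.
Implicit Types (eps : R) (k n : nat).

(** With the sign kept as a power of [odd k], a parity split decides at once whether a factor is 1 -
    exp or 1 + exp. *)
Lemma qX eps k : q eps ^+ k = (- 1) ^+ odd k * expR (eps * k%:R).
Proof. by rewrite /q (exprNn (expR eps)) expRM_natr signr_odd. Qed.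

Lemma aqX eps k :
  a eps * q eps ^+ k = (- 1) ^+ odd k * expR (eps * (2 * beta + k%:R)).
Proof.
rewrite qX mulrCA -expRD; congr (_ * expR _); ring.
Qed.

Lemma bqX eps k :
  b eps * q eps ^+ k = - ((- 1) ^+ odd k * expR (eps * (2 * alpha + 1 + k%:R))).
Proof.
rewrite qX mulNr mulrCA -expRD; congr (- (_ * expR _)); ring.
Qed.

Lemma abqX eps k :
  a eps * b eps * q eps ^+ k = - ((- 1) ^+ odd k * expR (eps * (s + k%:R))).
Proof.
rewrite -mulrA bqX mulrN mulrCA -expRD; congr (- (_ * expR _)).
by rewrite /s; ring.
Qed.

(** For every n the vanishing denominator factor is 1 - ab q^(2n+1), whence the common divisor s +
    2n + 1. Only the vanishing numerator factor depends on the parity of n. *)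
Definition upsilon_lim n : R :=
  (if odd n then (1 + g) * (2 * beta + n.+1%:R)
   else (1 - g) * (s + n.+1%:R)) / (s + (2 * n + 1)%:R).

Definition nu_lim n : R :=
  (if odd n then (1 + g) * (2 * alpha + 1 + n%:R)
   else (1 - g) * n%:R) / (s + (2 * n + 1)%:R).

(** The divisor is 2(alpha + beta + n + 1), nonzero by [hab]. *)
Lemma s_neq0 n : s + (2 * n + 1)%:R != 0.
Proof.
have -> : s + (2 * n + 1)%:R = 2 * (alpha + beta + n.+1%:R).
  by rewrite /s; ring.
by rewrite mulf_neq0 ?pnatr_eq0 // addr_eq0.
Qed.

(** The degenerate quotient is isolated in front; the other factor is continuous at eps = 0. Being a
    mere regrouping of factors and inverses, the identity holds for every eps, even where a
    denominator vanishes. *)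
Lemma upsilonE_even eps n : ~~ odd n ->
  upsilon (a eps) (b eps) (- g) (q eps) n =
  (1 - expR (eps * (s + n.+1%:R))) / (1 - expR (eps * (s + (2 * n + 1)%:R)))
  * ((1 + expR (eps * (2 * beta + n.+1%:R))) * (1 - g * expR (eps * n.+1%:R))
     / (1 + expR (eps * (s + (2 * n + 2)%:R)))).
Proof.
move=> /negbTE on; rewrite /upsilon !abqX aqX qX oddS on oddM2D1 oddM2D2 /=.
rewrite !(expr1, expr0, mulN1r, mul1r, opprK) !invfM; ring.
Qed.

Lemma upsilonE_odd eps n : odd n ->
  upsilon (a eps) (b eps) (- g) (q eps) n =
  (1 - expR (eps * (2 * beta + n.+1%:R))) / (1 - expR (eps * (s + (2 * n + 1)%:R)))
  * ((1 + expR (eps * (s + n.+1%:R))) * (1 + g * expR (eps * n.+1%:R))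
     / (1 + expR (eps * (s + (2 * n + 2)%:R)))).
Proof.
move=> on; rewrite /upsilon !abqX aqX qX oddS on oddM2D1 oddM2D2 /=.
rewrite !(expr1, expr0, mulN1r, mul1r, opprK) !invfM; ring.
Qed.

Lemma nuE_even eps n : ~~ odd n ->
  nu (a eps) (b eps) (- g) (q eps) n =
  (1 - expR (eps * n%:R)) / (1 - expR (eps * (s + (2 * n + 1)%:R)))
  * (- (expR (eps * (2 * beta + n.+1%:R)) * (g - expR (eps * (s + n%:R))))
     * (1 + expR (eps * (2 * alpha + 1 + n%:R)))
     / (1 + expR (eps * (s + (2 * n)%:R)))).
Proof.
move=> /negbTE on; rewrite /nu [a eps * - g]mulrC -[_ * a eps * _]mulrA.
rewrite [a eps * b eps * (- g)^-1]mulrC -[_ * (a eps * b eps) * _]mulrA.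
rewrite aqX !abqX bqX qX oddS on oddM2D1 oddM2 /= invrN.
rewrite !(expr1, expr0, mulN1r, mul1r, opprK, mulrNN, mulNr) !invfM.
(* The factor c of -ac q^(n+1) is absorbed into 1 - ab c^-1 q^n; this is where g must be nonzero. *)
have gK : g * g^-1 = 1 by rewrite divff.
rewrite -[g - _]mul1r -gK; ring: gK.
Qed.

Lemma nuE_odd eps n : odd n ->
  nu (a eps) (b eps) (- g) (q eps) n =
  (1 - expR (eps * (2 * alpha + 1 + n%:R))) / (1 - expR (eps * (s + (2 * n + 1)%:R)))
  * (expR (eps * (2 * beta + n.+1%:R)) * (g + expR (eps * (s + n%:R)))
     * (1 + expR (eps * n%:R))
     / (1 + expR (eps * (s + (2 * n)%:R)))).
Proof.
move=> on; rewrite /nu [a eps * - g]mulrC -[_ * a eps * _]mulrA.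
rewrite [a eps * b eps * (- g)^-1]mulrC -[_ * (a eps * b eps) * _]mulrA.
rewrite aqX !abqX bqX qX oddS on oddM2D1 oddM2 /= invrN.
rewrite !(expr1, expr0, mulN1r, mul1r, opprK, mulrNN, mulNr, mulrN) !invfM.
have gK : g * g^-1 = 1 by rewrite divff.
ring: gK.
Qed.

Lemma cvg_upsilon n :
  upsilon (a eps) (b eps) (- g) (q eps) n @[eps --> (0 : R)^'] --> upsilon_lim n.
Proof.
have cst (c : R) : c @[eps --> (0 : R)^'] --> c by exact: cvg_cst.
have nz : 1 + 1 != 0 :> R by rewrite -(natrD _ 1 1) pnatr_eq0.
rewrite /upsilon_lim; set B := s + (2 * n + 1)%:R; have B0 : B != 0 := s_neq0 n.
case: ifPn => on.
(* The limit takes the shape of [upsilonE_odd], with the quotient replaced by its limit and the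
   other exponentials by 1, so that the limit rules apply factor by factor. *)
- rewrite [X in _ --> X](_ : _ = (2 * beta + n.+1%:R) / B
    * ((1 + 1) * (1 + g * 1) / (1 + 1))); last by field.
  under eq_cvg do rewrite upsilonE_odd //.
  apply: cvgM; first exact: cvg_onesub_expR_ratio (s_neq0 n).
  apply: cvgM; last by apply: cvgV => //; apply: cvgD => //; exact: cvg_expRM.
  apply: cvgM; apply: cvgD => //; first exact: cvg_expRM.
  by apply: cvgM => //; exact: cvg_expRM.
- rewrite [X in _ --> X](_ : _ = (s + n.+1%:R) / B
    * ((1 + 1) * (1 - g * 1) / (1 + 1))); last by field.
  under eq_cvg do rewrite upsilonE_even //.
  apply: cvgM; first exact: cvg_onesub_expR_ratio (s_neq0 n).
  apply: cvgM; last by apply: cvgV => //; apply: cvgD => //; exact: cvg_expRM.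
  apply: cvgM; [apply: cvgD => // | apply: cvgB => //]; first exact: cvg_expRM.
  by apply: cvgM => //; exact: cvg_expRM.
Qed.

Lemma cvg_nu n :
  nu (a eps) (b eps) (- g) (q eps) n @[eps --> (0 : R)^'] --> nu_lim n.
Proof.
have cst (c : R) : c @[eps --> (0 : R)^'] --> c by exact: cvg_cst.
have nz : 1 + 1 != 0 :> R by rewrite -(natrD _ 1 1) pnatr_eq0.
rewrite /nu_lim; set B := s + (2 * n + 1)%:R; have B0 : B != 0 := s_neq0 n.
case: ifPn => on.
- rewrite [X in _ --> X](_ : _ = (2 * alpha + 1 + n%:R) / B
    * (1 * (g + 1) * (1 + 1) / (1 + 1))); last by field.
  under eq_cvg do rewrite nuE_odd //.
  apply: cvgM; first exact: cvg_onesub_expR_ratio (s_neq0 n).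
  apply: cvgM; last by apply: cvgV => //; apply: cvgD => //; exact: cvg_expRM.
  apply: cvgM; last by apply: cvgD => //; exact: cvg_expRM.
  apply: cvgM; first exact: cvg_expRM.
  by apply: cvgD => //; exact: cvg_expRM.
- rewrite [X in _ --> X](_ : _ = n%:R / B
    * (- (1 * (g - 1)) * (1 + 1) / (1 + 1))); last by field.
  under eq_cvg do rewrite nuE_even //.
  apply: cvgM; first exact: cvg_onesub_expR_ratio (s_neq0 n).
  apply: cvgM; last by apply: cvgV => //; apply: cvgD => //; exact: cvg_expRM.
  apply: cvgM; last by apply: cvgD => //; exact: cvg_expRM.
  apply: cvgN; apply: cvgM; first exact: cvg_expRM.
  by apply: cvgB => //; exact: cvg_expRM.
Qed.

(** The two numerators add up to (1 - g)(s + 2n + 1) for even n and to (1 + g)(s + 2n + 1) for odd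
    n, so the divisor cancels. *)
Lemma diag_lim n : 1 - upsilon_lim n - nu_lim n = (- 1) ^+ odd n * g.
Proof.
have := s_neq0 n; rewrite /upsilon_lim /nu_lim /s.
by rewrite natrD natrM; case: (odd n) => nz; field.
Qed.

(** Consecutive indices have opposite parity, so one contributes 1 - g and the other 1 + g. The
    remaining factors above and below are all even multiples, and their 2's cancel, leaving the
    coefficient of [chihara_recr_even]. *)
Lemma upsilonM_nu_lim_even m :
  upsilon_lim m.*2 * nu_lim m.*2.+1 = (1 - g ^+ 2) *
  ((alpha + beta + m%:R + 1) * (alpha + m%:R + 1)
    / ((alpha + beta + (2 * m + 1)%:R) * (alpha + beta + (2 * m + 2)%:R))).
Proof.
have nz1 : alpha + beta + (2 * m + 1)%:R != 0 by rewrite addn1 addr_eq0.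
have nz2 : alpha + beta + (2 * m + 2)%:R != 0 by rewrite addn2 addr_eq0.
rewrite /upsilon_lim /nu_lim /= odd_double /=.
have -> : s + (2 * m.*2 + 1)%:R = 2 * (alpha + beta + (2 * m + 1)%:R).
  by rewrite /s -mul2n; ring.
have -> : s + (2 * m.*2.+1 + 1)%:R = 2 * (alpha + beta + (2 * m + 2)%:R).
  by rewrite /s -mul2n; ring.
have -> : s + m.*2.+1%:R = 2 * (alpha + beta + m%:R + 1).
  by rewrite /s -mul2n; ring.
have -> : 2 * alpha + 1 + m.*2.+1%:R = 2 * (alpha + m%:R + 1).
  by rewrite -mul2n; ring.
by move: (alpha + beta + (2 * m + 1)%:R) (alpha + beta + (2 * m + 2)%:R) nz1 nz2
  => d1 d2 nz1 nz2; field; rewrite nz1 nz2.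
Qed.

Lemma upsilonM_nu_lim_odd m :
  upsilon_lim m.*2.+1 * nu_lim m.*2.+2 = (1 - g ^+ 2) *
  (m.+1%:R * (beta + m.+1%:R)
    / ((alpha + beta + (2 * m + 2)%:R) * (alpha + beta + (2 * m + 3)%:R))).
Proof.
have nz1 : alpha + beta + (2 * m + 2)%:R != 0 by rewrite addn2 addr_eq0.
have nz2 : alpha + beta + (2 * m + 3)%:R != 0 by rewrite addn3 addr_eq0.
rewrite /upsilon_lim /nu_lim /= odd_double /=.
have -> : s + (2 * m.*2.+1 + 1)%:R = 2 * (alpha + beta + (2 * m + 2)%:R).
  by rewrite /s -mul2n; ring.
have -> : s + (2 * m.*2.+2 + 1)%:R = 2 * (alpha + beta + (2 * m + 3)%:R).
  by rewrite /s -mul2n; ring.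
have -> : 2 * beta + m.*2.+2%:R = 2 * (beta + m.+1%:R).
  by rewrite -mul2n; ring.
have -> : m.*2.+2%:R = 2 * m.+1%:R :> R by rewrite -mul2n; ring.
by move: (alpha + beta + (2 * m + 2)%:R) (alpha + beta + (2 * m + 3)%:R) nz1 nz2
  => d1 d2 nz1 nz2; field; rewrite nz1 nz2.
Qed.

(** Multiplying the Chihara recurrence by r^(n+2) turns gamma = g/r into g and multiplies the
    off-diagonal coefficient by r^2 = 1 - g^2, which gives the limiting coefficients of the big
    q-Jacobi recurrence at the point rx. *)
Lemma scaled_chihara_recr (r : R) n : r != 0 -> r ^+ 2 = 1 - g ^+ 2 ->
  r ^+ n.+2 *: chihara alpha beta (g / r) n.+2 =
  (r *: 'X - ((- 1) ^+ odd n.+1 * g)%:P)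
    * (r ^+ n.+1 *: chihara alpha beta (g / r) n.+1)
  - (upsilon_lim n * nu_lim n.+1) *: (r ^+ n *: chihara alpha beta (g / r) n).
Proof.
move=> r0 r2.
have scale_step c sg (P Q S : {poly R}) : P = ('X - c%:P) * Q - sg *: S ->
    r ^+ n.+2 *: P = (r *: 'X - (r * c)%:P) * (r ^+ n.+1 *: Q)
      - (r ^+ 2 * sg) *: (r ^+ n *: S).
  move=> ->; rewrite -!mul_polyC !exprS !polyCM.
  by move: (r ^+ n)%:P => y; ring.
have [m [nE|nE]] : exists m, n = m.*2 \/ n = m.*2.+1.
  exists n./2; have := odd_double_half n.
  by case: (odd n) => nE; [right | left]; rewrite -[LHS]nE.
- rewrite nE upsilonM_nu_lim_even -r2 /= odd_double expr1.
  (* For even n the linear factor is x + gamma, so the diagonal entry to be scaled is -gamma. *)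
  rewrite [_ * g](_ : _ = r * - (g / r)); last by field.
  rewrite -nE; apply: scale_step; rewrite nE polyCN opprK.
  exact: chihara_recr_even.
- rewrite nE upsilonM_nu_lim_odd -r2 /= odd_double expr0.
  rewrite [_ * g](_ : _ = r * (g / r)); last by field.
  rewrite -nE; apply: scale_step; rewrite nE.
  exact: chihara_recr_odd.
Qed.

Lemma cvg_big_qJacobi (r x : R) n : r != 0 -> r ^+ 2 = 1 - g ^+ 2 ->
  (big_qJacobi (a eps) (b eps) (- g) (q eps) n).[x * r] @[eps --> (0 : R)^'] -->
  r ^+ n * (chihara alpha beta (g / r) n).[x].
Proof.
move=> r0 r2.
have cst (c : R) : c @[eps --> (0 : R)^'] --> c by exact: cvg_cst.
have coefE n1 : 1 - upsilon (a eps) (b eps) (- g) (q eps) n1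
    - nu (a eps) (b eps) (- g) (q eps) n1 @[eps --> (0 : R)^'] -->
    (- 1) ^+ odd n1 * g.
  rewrite -diag_lim; apply: cvgB; last exact: cvg_nu.
  by apply: cvgB => //; exact: cvg_upsilon.
(* The recurrence reaches back two indices, so the induction carries two consecutive limits. *)
suff [] : ((big_qJacobi (a eps) (b eps) (- g) (q eps) n).[x * r]
      @[eps --> (0 : R)^'] --> r ^+ n * (chihara alpha beta (g / r) n).[x]) /\
    ((big_qJacobi (a eps) (b eps) (- g) (q eps) n.+1).[x * r]
      @[eps --> (0 : R)^'] --> r ^+ n.+1 * (chihara alpha beta (g / r) n.+1).[x]).
  by [].
elim: n => [|n [IHn IHn1]]; split => //.
- have -> : chihara alpha beta (g / r) 0 = 1.
    rewrite (chihara_double _ hab 0) /monic_hyp poly_def big_ord1.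
    by rewrite monic_hyp_coefnn scale1r expr0 comp_polyC.
  rewrite expr0 mul1r -polyC1 hornerC.
  under eq_cvg do rewrite /= -polyC1 hornerC.
  exact: cst.
- have -> : chihara alpha beta (g / r) 1 = 'X - (g / r)%:P.
    rewrite (chihara_doubleS _ hab 0) /monic_hyp poly_def big_ord1.
    by rewrite monic_hyp_coefnn scale1r expr0 comp_polyC mulr1.
  rewrite hornerXsubC.
  have -> : r ^+ 1 * (x - g / r) = x * r - (- 1) ^+ odd 0 * g by field.
  have P1 eps : big_qJacobi (a eps) (b eps) (- g) (q eps) 1 =
      'X - (1 - upsilon (a eps) (b eps) (- g) (q eps) 0
            - nu (a eps) (b eps) (- g) (q eps) 0)%:P.
    by rewrite /= mulr1 subr0.
  under eq_cvg do rewrite P1 hornerXsubC.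
  by apply: cvgB => //; exact: coefE.
- rewrite -hornerZ scaled_chihara_recr //.
  rewrite hornerD hornerM hornerN !hornerZ hornerD hornerN hornerC hornerZ hornerX.
  under eq_cvg do
    rewrite [big_qJacobi _ _ _ _ n.+2]/= hornerD hornerN hornerM hornerXsubC hornerZ.
  apply: cvgB.
    apply: cvgM => //; rewrite [r * x]mulrC; apply: cvgB => //; exact: coefE.
  apply: cvgM => //; apply: cvgM; [exact: cvg_upsilon | exact: cvg_nu].
Qed.
End CoefficientLimits.

Theorem mainTheorem5 (R : realType) (alpha beta g : R)
    (hg : 0 < `|g| < 1)
    (hab : forall k : nat, alpha + beta != - k.+1%:R)
    (n : nat) (x : R) :
  ((1 - g ^+ 2) `^ (- n%:R / 2) *
     (big_qJacobi (expR (2 * eps * beta)) (- expR (eps * (2 * alpha + 1)))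
        (- g) (- expR eps) n).[x * Num.sqrt (1 - g ^+ 2)])
    @[eps --> (0 : R)^'] -->
  (chihara alpha beta (g / Num.sqrt (1 - g ^+ 2)) n).[x].
Proof.
have [g0 g1] : g != 0 /\ `|g| < 1.
  by case/andP: hg => g_gt0 ->; rewrite -normr_gt0.
have g2 : 0 < 1 - g ^+ 2 by rewrite subr_gt0 -real_normK ?num_real // expr_lt1.
set r := Num.sqrt (1 - g ^+ 2).
have r_gt0 : 0 < r by rewrite sqrtr_gt0.
have r0 : r != 0 by rewrite gt_eqF.
have r2 : r ^+ 2 = 1 - g ^+ 2 by rewrite sqr_sqrtr // ltW.
have -> : (1 - g ^+ 2) `^ (- n%:R / 2) = (r ^+ n)^-1.
  by rewrite mulrC powRrM powR12_sqrt ?ltW // powRN powR_mulrn //.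
(* The target is written as r^-n (r^n C_n(x)), so that the constant factor r^-n splits off the
   limit. *)
rewrite -[X in _ --> X](mulKf (expf_neq0 n r0)).
by apply: cvgM; [exact: cvg_cst | exact: cvg_big_qJacobi].
Qed.
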